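(* Let $n\ge 5$ and $m\ge 2$. There exist nontrivial invariant projections onto the cycle space $Z(\mathbb{Z}_n^m)$ of the $m$-dimensional discrete torus $\mathbb{Z}_n^m$, i.e. invariant projections of the edge space onto $Z(\mathbb{Z}_n^m)$ different from the orthogonal projection.
   Context: $\mathbb{Z}_n^m$ is regarded as the graph with vertex set $\mathbb{Z}_n^m$ in which two vertices are adjacent if and only if they differ in exactly one coordinate and in that coordinate differ by $\pm1$ mod $n$. For a finite graph $G=(V,E)$ with a fixed arbitrary orientation of edges (tail $e^-$, head $e^+$), the cycle space is $Z(G)=\{F\in\mathbb{R}^E:\ \sum_{e^+=v}F(e)=\sum_{e^-=v}F(e)\text{ for all }v\in V\}$. For an edge $uv$, $\overrightarrow{uv}\in\mathbb{R}^E$ is its unit basis vector if it is oriented from $u$ to $v$, and $\overrightarrow{vu}=-\overrightarrow{uv}$. Each graph automorphism $\phi$ induces the linear map $\hat\phi$ of $\mathbb{R}^E$ with $\hat\phi(\overrightarrow{uv})=\overrightarrow{\phi(u)\phi(v)}$. A linear projection $P$ of $\mathbb{R}^E$ onto $Z(G)$ is invariant if $P\hat\phi=\hat\phi P$ for every graph automorphism $\phi$ (for these $3$-connected graphs the linear isometries of $\ell_1(E)$ preserving $Z(G)$ are, up to sign, exactly the $\hat\phi$). Orthogonality is with respect to the standard inner product on $\mathbb{R}^E$. *)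

(* Defs.v *)
From mathcomp Require Import all_boot all_order all_algebra all_fingroup.
From mathcomp Require Import reals.

Set Implicit Arguments.
Unset Strict Implicit.
Unset Printing Implicit Defensive.

Import GRing.Theory Num.Theory.
Local Open Scope ring_scope.

Section Graph.
Variables (V : finType) (adj : rel V).

Definition orientation_of (o : rel V) : Prop :=
  (forall u v, o u v -> adj u v) /\
  (forall u v, adj u v -> o u v (+) o v u).

Definition graph_automorphism (phi : {perm V}) : Prop :=
  forall u v, adj (phi u) (phi v) = adj u v.

End Graph.

(* When [o] orients a graph, every edge is represented by exactly one ordered
   pair (tail, head), so [edge o] is a copy of the edge set. *)
Notation edge o := {p : _ * _ | o p.1 p.2}.

Section EdgeSpace.
Variables (R : realType) (V : finType) (o : rel V).

Definition tail (e : edge o) : V := (val e).1.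
Definition head (e : edge o) : V := (val e).2.

Definition edge_space := {ffun edge o -> R^o}.

Definition cycle_space (F : edge_space) : Prop :=
  forall v : V, \sum_(e | head e == v) F e = \sum_(e | tail e == v) F e.

(* The vector of the edge uv directed from u to v: the unit vector of that
   edge or its opposite, and 0 when u and v are not adjacent. *)
Definition arrow (u v : V) : edge_space :=
  [ffun e => (val e == (u, v))%:R - (val e == (v, u))%:R].

(* The linear extension of [arrow u v |-> arrow (phi u) (phi v)]. *)
Definition induced (phi : {perm V}) (F : edge_space) : edge_space :=
  \sum_e F e *: arrow (phi (tail e)) (phi (head e)).

Definition inner (F G : edge_space) : R := \sum_e F e * G e.

Definition projection_onto_cycles (P : {linear edge_space -> edge_space}) :
    Prop :=
  (forall F, P (P F) = P F) /\
  (forall F, cycle_space F <-> exists G, P G = F).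

Definition invariant_projection (adj : rel V)
    (P : {linear edge_space -> edge_space}) : Prop :=
  projection_onto_cycles P /\
  forall phi, graph_automorphism adj phi ->
    forall F, P (induced phi F) = induced phi (P F).

Definition orthogonal_projection (P : {linear edge_space -> edge_space}) :
    Prop :=
  projection_onto_cycles P /\
  forall F G, cycle_space G -> inner (F - P F) G = 0.

Lemma arrowN u v : arrow v u = - arrow u v.
Proof. by apply/ffunP=> e; rewrite !ffunE opprB. Qed.

Lemma arrowE (adj : rel V) (e : edge o) : orientation_of adj o ->
  arrow (tail e) (head e) = [ffun e' => (e' == e)%:R].
Proof.
move=> [oadj adjo]; apply/ffunP=> e'; rewrite !ffunE -surjective_pairing.
rewrite (inj_eq val_inj); case: (val e' =P _) => [e'E|_]; last by rewrite subr0.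
have /= oe := valP e; have := adjo _ _ (oadj _ _ oe); rewrite oe /=.
by have /= := valP e'; rewrite e'E /= => ->.
Qed.

Lemma induced_arrow (adj : rel V) (phi : {perm V}) u v :
  orientation_of adj o -> adj u v ->
  induced phi (arrow u v) = arrow (phi u) (phi v).
Proof.
have ind a b (oab : o a b) : orientation_of adj o ->
    induced phi (arrow a b) = arrow (phi a) (phi b).
  move=> ho; pose e : edge o := exist _ (a, b) oab.
  rewrite /induced -[arrow a b]/(arrow (tail e) (head e)) (arrowE e ho).
  rewrite (bigD1 e) //= big1 => [|e' /negPf ne]; last first.
    by rewrite ffunE ne scale0r.
  by rewrite ffunE eqxx scale1r addr0.
move=> ho uv; case: (boolP (o u v)) => [ouv|nouv]; first exact: ind.
have ovu : o v u by have := ho.2 _ _ uv; rewrite (negPf nouv).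
rewrite arrowN [RHS]arrowN -(ind _ _ ovu ho) /induced -sumrN.
by apply: eq_bigr => e _; rewrite ffunE scaleNr.
Qed.

End EdgeSpace.

(* ['Z_n] is the ring of integers mod n only when 1 < n. *)
Definition torus (n m : nat) := {ffun 'I_m -> 'Z_n}.

Definition torus_adj (n m : nat) : rel (torus n m) := fun u v =>
  [exists i, ((v i == u i + 1) || (v i == u i - 1)) &&
             [forall j, (j != i) ==> (v j == u j)]].

(* Main.v *)
(* If S is an equivariant linear map from potentials (functions on vertices)
   to cycles, and P0 is the orthogonal projection onto the cycle space, then
   P0 + S o div is again an invariant projection, and it differs from P0 as
   soon as S o div is nonzero.  A suitable S sends the unit potential at v to
   the sum of the oriented 4-cycles in a certain position relative to v.  This
   position is expressed only through adjacency and codegrees, so equivariance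
   under all automorphisms is automatic and the automorphism group of the
   torus need not be computed. *)
Require Import Defs.
From HB Require Import structures.
From mathcomp Require Import all_boot all_order all_algebra all_fingroup.
From mathcomp Require Import reals ring.

Set Implicit Arguments.
Unset Strict Implicit.
Unset Printing Implicit Defensive.

Import GRing.Theory Num.Theory.
Local Open Scope ring_scope.

Local Notation head := Defs.head.

(** * Codegrees and marked squares *)

Definition codegree (V : finType) (adj : rel V) (u v : V) : nat :=
  #|[set x | adj u x && adj v x]|.

(* In the torus with n >= 5 these are the unit squares with
   a = v + e, b = v + 2e, c = v + 2e + f, d = v + e + f, for +-e and +-f unit
   vectors of distinct axes; the reverse traversal has b and d exchanged and
   is excluded by the codegree conditions, so nothing cancels. *)
Definition marked_square (V : finType) (adj : rel V) (v a b c d : V) : bool :=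
  [&& adj v a, adj a b, adj b c, adj c d, adj d a, c != a,
      codegree adj v b == 1%N & codegree adj v d != 1%N].

(** * Divergence, gradient, and the splitting of the edge space *)

Section EdgeCalculus.
Variables (R : realType) (V : finType) (o : rel V).

Local Notation E := (edge_space R o).
Local Notation potential := {ffun V -> R^o}.
Local Notation arrow := (@arrow R V o).

Lemma innerDl (F G H : E) : inner (F + G) H = inner F H + inner G H.
Proof.
by rewrite /inner -big_split; apply: eq_bigr => e _; rewrite ffunE mulrDl.
Qed.

Lemma innerZl k (F H : E) : inner (k *: F) H = k * inner F H.
Proof.
by rewrite /inner mulr_sumr; apply: eq_bigr => e _; rewrite ffunE mulrA.
Qed.

Lemma innerC (F G : E) : inner F G = inner G F.
Proof. by apply: eq_bigr => e _; rewrite mulrC. Qed.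

Lemma innerNl (F H : E) : inner (- F) H = - inner F H.
Proof. by rewrite -scaleN1r innerZl mulN1r. Qed.

Lemma inner_suml I (r : seq I) (P : pred I) (F : I -> E) (H : E) :
  inner (\sum_(i <- r | P i) F i) H = \sum_(i <- r | P i) inner (F i) H.
Proof.
apply: (big_morph (fun F => inner F H)) => [F1 F2|]; first exact: innerDl.
by rewrite -(scale0r 0) innerZl mul0r.
Qed.

Lemma inner_eq0 (F : E) : inner F F = 0 -> F = 0.
Proof.
move=> /eqP; rewrite psumr_eq0 => [/allP h|e _]; last exact: sqr_ge0.
apply/ffunP => e; rewrite ffunE; have := h e (mem_index_enum _).
by rewrite /= mulf_eq0 orbb => /eqP.
Qed.

Lemma induced_is_linear (phi : {perm V}) : linear (@induced R V o phi).
Proof.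
move=> k F G; rewrite /induced scaler_sumr -big_split; apply: eq_bigr => e _.
by rewrite !ffunE /= scalerDl scalerA.
Qed.

HB.instance Definition _ (phi : {perm V}) :=
  GRing.isLinear.Build R E E _ (@induced R V o phi) (induced_is_linear phi).

(** Arrows between non-adjacent vertices are 0, so the sum may run over all [u]; it is the inflow
    minus the outflow at [v]. *)
Definition divergence (F : E) : potential :=
  [ffun v => \sum_u inner F (arrow u v)].

Lemma divergence_is_linear : linear divergence.
Proof.
move=> k F G; apply/ffunP => v; rewrite !ffunE /= scaler_sumr.
by rewrite -big_split; apply: eq_bigr => u _; rewrite innerDl innerZl.
Qed.

HB.instance Definition _ :=
  GRing.isLinear.Build R E potential _ divergence divergence_is_linear.

(** The adjoint of [divergence]: its value on an edge is [g] at the head minus [g] at the tail, so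
    its image is the cut space. *)
Definition gradient (g : potential) : E := \sum_v g v *: \sum_u arrow u v.

Lemma gradient_is_linear : linear gradient.
Proof.
move=> k g h; rewrite /gradient scaler_sumr -big_split; apply: eq_bigr => v _.
by rewrite !ffunE /= scalerDl scalerA.
Qed.

HB.instance Definition _ :=
  GRing.isLinear.Build R potential E _ gradient gradient_is_linear.

Lemma inner_gradient (F : E) (g : potential) :
  inner F (gradient g) = \sum_v g v * divergence F v.
Proof.
rewrite innerC inner_suml; apply: eq_bigr => v _.
rewrite innerZl inner_suml ffunE; congr (_ * _).
by apply: eq_bigr => u _; rewrite innerC.
Qed.

Lemma divergence_gradient_orthogonal (F : E) g :
  divergence F = 0 -> inner (gradient g) F = 0.
Proof.
move=> F0; rewrite innerC inner_gradient F0 big1 // => v _.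
by rewrite ffunE mulr0.
Qed.

(** By adjointness, a gradient of zero divergence is orthogonal to itself. *)
Lemma cycle_gradient_trivial :
  (lker (linfun divergence) :&: limg (linfun gradient))%VS = 0%VS.
Proof.
apply/eqP; rewrite -subv0; apply/subvP => F; rewrite memv_cap => /andP[].
rewrite memv_ker lfunE /= => /eqP F0 /memv_imgP[g _]; rewrite lfunE /= => Fg.
rewrite memv0; apply/eqP/inner_eq0; rewrite {1}Fg.
exact: divergence_gradient_orthogonal.
Qed.

(* The image of the divergence meets the kernel of the gradient trivially, so
   the rank of the divergence is at most that of the gradient. *)
Lemma cycle_gradient_full :
  (lker (linfun divergence) + limg (linfun gradient))%VS = fullv.
Proof.
apply/eqP; rewrite eqEdim subvf dimv_disjoint_sum ?cycle_gradient_trivial //=.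
rewrite -[X in (X <= _)%N](limg_ker_dim (linfun divergence) fullv) capfv leq_add2l.
rewrite -(leq_add2l (\dim (lker (linfun gradient)))).
have := limg_ker_dim (linfun gradient) fullv; rewrite capfv => ->.
rewrite -dimv_disjoint_sum.
  exact: dimvS (subvf _).
apply/eqP; rewrite -subv0; apply/subvP => k; rewrite memv_cap => /andP[].
rewrite memv_ker lfunE /= => /eqP k0 /memv_imgP[F _]; rewrite lfunE /= => kF.
(* By adjointness the sum is the inner product of [F] with the gradient of [k]; since [k] is the
   divergence of [F], it is also a sum of squares. *)
have /eqP : \sum_v k v * divergence F v = 0.
  by rewrite -inner_gradient k0 innerC -(scale0r 0) innerZl mul0r.
rewrite -kF psumr_eq0 => [/allP h|v _]; last exact: sqr_ge0.
rewrite memv0; apply/eqP/ffunP => v; rewrite ffunE.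
by have := h v (mem_index_enum _); rewrite /= mulf_eq0 orbb => /eqP.
Qed.

End EdgeCalculus.

(** * Divergence of arrows in an oriented graph *)

Section InvariantProjection.
Variables (R : realType) (V : finType) (adj o : rel V).
Hypotheses (ho : orientation_of adj o) (adj_sym : symmetric adj).

Local Notation E := (edge_space R o).
Local Notation potential := {ffun V -> R^o}.
Local Notation arrow := (@arrow R V o).
Local Notation divergence := (@divergence R V o).
Local Notation gradient := (@gradient R V o).

Lemma orientation_irreflexive u : adj u u = false.
Proof. by apply/negP => /(ho.2 _ _); rewrite addbb. Qed.

(** Allows sums over all pairs of vertices to be transported by automorphisms without tracking
    adjacency. *)
Lemma arrow_nonadj u v : ~~ adj u v -> arrow u v = 0.
Proof.
move=> nuv; apply/ffunP => e; rewrite !ffunE.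
have euv : val e == (u, v) = false.
  apply: contraNF nuv => /eqP eE; have /= := valP e.
  by rewrite eE => /(ho.1 _ _).
have evu : val e == (v, u) = false.
  apply: contraNF nuv => /eqP eE; have /= := valP e.
  by rewrite eE adj_sym => /(ho.1 _ _).
by rewrite euv evu subrr.
Qed.

Lemma inner_arrow_arrow x y u v : adj x y ->
  inner (arrow x y) (arrow u v) =
  ((x == u) && (y == v))%:R - ((x == v) && (y == u))%:R.
Proof.
have pos a b (oab : o a b) : inner (arrow a b) (arrow u v) =
    ((a == u) && (b == v))%:R - ((a == v) && (b == u))%:R.
  pose e : edge o := exist _ (a, b) oab.
  rewrite -[arrow a b]/(arrow (tail e) (head e)) (arrowE _ e ho) /inner.
  rewrite (bigD1 e) //= big1 => [|e' /negPf ne]; last by rewrite ffunE ne mul0r.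
  by rewrite !ffunE eqxx mul1r addr0 /= !xpair_eqE.
move=> /(ho.2 _ _); case: (boolP (o x y)) => [oxy _|_ /= oyx]; first exact: pos.
by rewrite arrowN innerNl pos // opprB andbC [in X in _ - X]andbC.
Qed.

Lemma divergence_arrow x y v : adj x y ->
  divergence (arrow x y) v = (y == v)%:R - (x == v)%:R.
Proof.
move=> xy; rewrite ffunE; under eq_bigr do rewrite inner_arrow_arrow //.
rewrite sumrB (bigD1 x) //= eqxx big1 => [|u /negPf ux]; last first.
  by rewrite eq_sym ux.
rewrite (bigD1 y) //= eqxx andbT big1 => [|u /negPf uy]; last first.
  by rewrite [y == u]eq_sym uy andbF.
by rewrite !addr0.
Qed.

Lemma edge_space_arrowE (F : E) : F = \sum_e F e *: arrow (tail e) (head e).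
Proof.
apply/ffunP => e; rewrite sum_ffunE (bigD1 e) //= big1 => [|e' /negPf ne].
  by rewrite ffunE (arrowE _ _ ho) ffunE eqxx addr0 -[_ *: _]/(_ * _) mulr1.
by rewrite ffunE (arrowE _ _ ho) ffunE eq_sym ne scaler0.
Qed.

Lemma edge_adj (e : edge o) : adj (tail e) (head e).
Proof. exact: ho.1 (valP e). Qed.

Lemma divergenceE (F : E) v : divergence F v =
  \sum_(e | head e == v) F e - \sum_(e | tail e == v) F e.
Proof.
rewrite {1}(edge_space_arrowE F) linear_sum sum_ffunE.
rewrite [in RHS]big_mkcond [X in _ - X]big_mkcond -sumrB.
apply: eq_bigr => e _; rewrite linearZ ffunE divergence_arrow ?edge_adj //.
rewrite -[_ *: _]/(_ * _) mulrBr.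
by do 2!case: eqP => _; rewrite ?mulr1 ?mulr0.
Qed.

Lemma cycle_space_divergence (F : E) : cycle_space F <-> divergence F = 0.
Proof.
split=> [h|F0 v]; first by apply/ffunP => v; rewrite divergenceE h subrr ffunE.
by apply/eqP; rewrite -subr_eq0 -divergenceE F0 ffunE.
Qed.

(** The divergences of the arrows are differences of unit potentials, which telescope around the
    closed walk. *)
Lemma divergence_square a b c d : adj a b -> adj b c -> adj c d -> adj d a ->
  divergence (arrow a b + arrow b c + arrow c d + arrow d a) = 0.
Proof.
pose delta x : potential := [ffun v => (x == v)%:R].
have divE x y : adj x y -> divergence (arrow x y) = delta y - delta x.
  move=> xy; apply/ffunP => v; rewrite divergence_arrow //.
  by rewrite /delta !ffunE.
have tele (x y z : potential) : (y - x) + (z - y) = z - x.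
  by rewrite addrC addrA subrK.
by move=> ab bc cd da; rewrite !linearD /= !divE // !tele subrr.
Qed.

(** * Equivariance under graph automorphisms *)

Section Automorphism.
Variables (phi : {perm V}) (autphi : graph_automorphism adj phi).

Lemma induced_arrow_all u v :
  induced phi (arrow u v) = arrow (phi u) (phi v).
Proof.
case: (boolP (adj u v)) => [uv|nuv]; first exact: (induced_arrow _ _ ho).
by rewrite !arrow_nonadj ?autphi // linear0.
Qed.

Lemma divergence_induced (F : E) v :
  divergence (induced phi F) (phi v) = divergence F v.
Proof.
rewrite [in RHS](edge_space_arrowE F) /induced !linear_sum !sum_ffunE.
apply: eq_bigr => e _; rewrite !linearZ ffunE [RHS]ffunE.
by rewrite !divergence_arrow ?autphi ?edge_adj // !(inj_eq perm_inj).
Qed.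

Lemma induced_gradient g :
  induced phi (gradient g) = gradient [ffun v => g ((phi^-1)%g v)].
Proof.
rewrite /gradient linear_sum [RHS](reindex_inj (@perm_inj _ phi)).
apply: eq_bigr => v _; rewrite linearZ ffunE permK linear_sum; congr (_ *: _).
rewrite [RHS](reindex_inj (@perm_inj _ phi)).
by apply: eq_bigr => u _; rewrite /= induced_arrow_all.
Qed.

Lemma codegree_perm u v : codegree adj (phi u) (phi v) = codegree adj u v.
Proof.
rewrite /codegree -[RHS](card_imset _ (@perm_inj _ phi)); apply: eq_card => x.
rewrite -(permKV phi x) (mem_imset _ _ perm_inj) !inE.
by rewrite -!(autphi _ (_ x)).
Qed.

Lemma marked_square_perm v a b c d :
  marked_square adj (phi v) (phi a) (phi b) (phi c) (phi d) =
  marked_square adj v a b c d.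
Proof.
by rewrite /marked_square !autphi !codegree_perm (inj_eq perm_inj).
Qed.

End Automorphism.

(** * The flow map and the perturbed projection *)

Definition marked_flow (v : V) : E :=
  \sum_a \sum_b \sum_c \sum_(d | marked_square adj v a b c d)
    (arrow a b + arrow b c + arrow c d + arrow d a).

Lemma divergence_marked_flow v : divergence (marked_flow v) = 0.
Proof.
rewrite /marked_flow linear_sum big1 // => a _; rewrite linear_sum big1 // => b _.
rewrite linear_sum big1 // => c _; rewrite linear_sum big1 // => d.
by case/and5P=> _ ab bc cd /andP[da _]; apply: divergence_square.
Qed.

Lemma induced_marked_flow (phi : {perm V}) v : graph_automorphism adj phi ->
  induced phi (marked_flow v) = marked_flow (phi v).
Proof.
move=> autphi; rewrite /marked_flow.
rewrite linear_sum [RHS](reindex_inj (@perm_inj _ phi)).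
apply: eq_bigr => a _; rewrite linear_sum [RHS](reindex_inj (@perm_inj _ phi)).
apply: eq_bigr => b _; rewrite linear_sum [RHS](reindex_inj (@perm_inj _ phi)).
apply: eq_bigr => c _; rewrite linear_sum [RHS](reindex_inj (@perm_inj _ phi)).
apply: eq_big => [d|d _]; first by rewrite marked_square_perm.
by rewrite !linearD /= !induced_arrow_all.
Qed.

(** The map S, extended linearly from unit potentials. *)
Definition flow_map (g : potential) : E := \sum_v g v *: marked_flow v.

Lemma flow_map_is_linear : linear flow_map.
Proof.
move=> k g h; rewrite /flow_map scaler_sumr -big_split; apply: eq_bigr => v _.
by rewrite !ffunE /= scalerDl scalerA.
Qed.

HB.instance Definition _ :=
  GRing.isLinear.Build R potential E _ flow_map flow_map_is_linear.

(** The two subspaces are orthogonal and together span, so this is the orthogonal projection P0. *)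
Definition cycle_projection : 'End(E) :=
  daddv_pi (lker (linfun divergence)) (limg (linfun gradient)).

Lemma cycle_projection_id (F : E) :
  divergence F = 0 -> cycle_projection F = F.
Proof.
move=> F0; apply: daddv_pi_id; first exact: cycle_gradient_trivial.
by rewrite memv_ker lfunE /= F0.
Qed.

Lemma divergence_cycle_projection (F : E) : divergence (cycle_projection F) = 0.
Proof.
have := memv_pi (lker (linfun divergence)) (limg (linfun gradient)) F.
by rewrite memv_ker lfunE /= => /eqP.
Qed.

Lemma cycle_projection_gradient g : cycle_projection (gradient g) = 0.
Proof.
have gB : gradient g \in limg (linfun gradient).
  by apply/memv_imgP; exists g; rewrite ?memvf ?lfunE.
have triv := @cycle_gradient_trivial R V o.
(* The two complementary projections add up to the identity, and the one onto gradients already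
   fixes [gradient g]. *)
have /esym/eqP := daddv_pi_add triv (subvP (addvSr _ _) _ gB).
rewrite (daddv_pi_id _ gB) 1?capvC // -subr_eq subrr.
by move=> /eqP <-.
Qed.

Lemma cycle_projectionE (F : E) : exists g, F = cycle_projection F + gradient g.
Proof.
have : F \in (lker (linfun divergence) + limg (linfun gradient))%VS.
  by rewrite cycle_gradient_full memvf.
case/memv_addP=> z; rewrite memv_ker lfunE /= => /eqP z0.
case=> _ /memv_imgP[g _ ->] ->; rewrite lfunE /=; exists g.
by rewrite linearD /= cycle_projection_gradient addr0 cycle_projection_id.
Qed.

Definition perturbed_projection (F : E) : E :=
  cycle_projection F + flow_map (divergence F).

Lemma perturbed_projection_is_linear : linear perturbed_projection.
Proof.
move=> k F G; rewrite /perturbed_projection !linearP /=.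
by rewrite scalerDr addrACA.
Qed.

HB.instance Definition _ :=
  GRing.isLinear.Build R E E _ perturbed_projection
    perturbed_projection_is_linear.

Lemma divergence_flow_map g : divergence (flow_map g) = 0.
Proof.
rewrite linear_sum big1 // => v _.
by rewrite linearZ /= divergence_marked_flow scaler0.
Qed.

Lemma perturbed_projection_id (F : E) :
  divergence F = 0 -> perturbed_projection F = F.
Proof.
move=> F0; rewrite /perturbed_projection F0 linear0 addr0.
exact: cycle_projection_id.
Qed.

Lemma divergence_perturbed_projection (F : E) :
  divergence (perturbed_projection F) = 0.
Proof.
by rewrite linearD /= divergence_cycle_projection divergence_flow_map addr0.
Qed.

(** Fixing every cycle and taking only cycles as values gives both idempotence and the image. *)
Lemma perturbed_projection_onto_cycles :
  projection_onto_cycles perturbed_projection.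
Proof.
split=> F.
  exact/perturbed_projection_id/divergence_perturbed_projection.
split=> [/cycle_space_divergence F0|[G <-]].
  by exists F; apply: perturbed_projection_id.
exact/cycle_space_divergence/divergence_perturbed_projection.
Qed.

Lemma induced_flow_map (phi : {perm V}) (F : E) : graph_automorphism adj phi ->
  flow_map (divergence (induced phi F)) = induced phi (flow_map (divergence F)).
Proof.
move=> autphi; rewrite /flow_map [RHS]linear_sum.
rewrite [LHS](reindex_inj (@perm_inj _ phi)); apply: eq_bigr => v _.
by rewrite linearZ /= induced_marked_flow // divergence_induced.
Qed.

(** An automorphism carries the splitting of [F] to that of its image: gradients go to gradients,
    and zero divergence is preserved. *)
Lemma induced_cycle_projection (phi : {perm V}) (F : E) :
  graph_automorphism adj phi ->
  cycle_projection (induced phi F) = induced phi (cycle_projection F).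
Proof.
move=> autphi; have [g {1}->] := cycle_projectionE F.
rewrite !linearD /= induced_gradient // cycle_projection_gradient addr0.
apply: cycle_projection_id; apply/ffunP => v.
rewrite -(permKV phi v) divergence_induced // divergence_cycle_projection.
by rewrite !ffunE.
Qed.

Lemma perturbed_projection_invariant :
  invariant_projection adj perturbed_projection.
Proof.
split=> [|phi autphi F]; first exact: perturbed_projection_onto_cycles.
rewrite /= /perturbed_projection induced_cycle_projection //.
by rewrite induced_flow_map // -linearD.
Qed.

(** * Nonorthogonality in triangle-free graphs *)

Section Nonorthogonal.
Hypothesis triangle_free : forall u v x,
  adj u v -> adj u x -> adj v x -> False.

Lemma codegree_adj u v : adj u v -> codegree adj u v = 0%N.
Proof.
move=> uv; apply/eqP; rewrite cards_eq0; apply/eqP/setP => x; rewrite !inE.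
by apply/negP => /andP[]; apply: triangle_free uv.
Qed.

Lemma codegree1_inj u v x y : codegree adj u v == 1%N ->
  adj u x -> adj v x -> adj u y -> adj v y -> x = y.
Proof.
move=> /cards1P[z sE] ux vx uy vy.
have /set1P -> : x \in [set z] by rewrite -sE inE ux.
by have /set1P -> : y \in [set z] by rewrite -sE inE uy.
Qed.

(** Codegrees at [v] separate the roles: [y] is not the neighbour [a], [t] is not [b], and [z = a]
    with [y = b] would give [v] and [y] two common neighbours. So the edge from [a] to [b] is never
    traversed backwards, and no contributions cancel. *)
Lemma marked_square_inner_root v a b c d x y z t :
  marked_square adj v a b c d -> marked_square adj v x y z t ->
  inner (arrow x y + arrow y z + arrow z t + arrow t x) (arrow a b) =
  ((x == a) && (y == b))%:R.
Proof.
case/and5P=> va ab bc cd /and4P[da /eqP ca vb1 vd1].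
case/and5P=> vx xy yz zt /and4P[tx /eqP zx vy1 vt1].
have ya : (y == a) = false.
  by apply: contraTF vy1 => /eqP->; rewrite codegree_adj.
have tb : (t == b) = false by apply: contraNF vt1 => /eqP->.
have za : (y == b) && (z == a) = false.
  apply/negP => /andP[/eqP _ /eqP zE]; subst z; apply: zx.
  by apply: (codegree1_inj vy1) => //; rewrite adj_sym.
have ta : (t == a) = false.
  by apply/negP => /eqP tE; subst t; apply: (triangle_free va vx tx).
rewrite !innerDl !inner_arrow_arrow // ya tb za ta !andbF /=.
by rewrite !subr0 !addr0.
Qed.

(** The root [a] lies on none of the squares marked at it, so no edge at [a] is used. *)
Lemma marked_square_inner_neighbor a b x y z t :
  marked_square adj a x y z t ->
  inner (arrow x y + arrow y z + arrow z t + arrow t x) (arrow a b) = 0.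
Proof.
case/and5P=> ax xy yz zt /and4P[tx /eqP zx ay1 at1].
have xa : (x == a) = false.
  by apply/negP => /eqP xE; move: ax; rewrite xE orientation_irreflexive.
have ya : (y == a) = false.
  apply/negP => /eqP yE; subst y; apply: zx.
  by apply: (codegree1_inj ay1).
have za : (z == a) = false.
  apply/negP => /eqP zE; subst z.
  by apply: (triangle_free ax _ xy); rewrite adj_sym.
have ta : (t == a) = false.
  apply/negP => /eqP tE; subst t; apply: zx.
  by apply: (codegree1_inj ay1); rewrite // adj_sym.
by rewrite !innerDl !inner_arrow_arrow // xa ya za ta !andbF subrr !addr0.
Qed.

Lemma inner_marked_flow v H : inner (marked_flow v) H =
  \sum_a \sum_b \sum_c \sum_(d | marked_square adj v a b c d)
    inner (arrow a b + arrow b c + arrow c d + arrow d a) H.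
Proof.
rewrite inner_suml; apply: eq_bigr => a _; rewrite inner_suml.
apply: eq_bigr => b _; rewrite inner_suml; apply: eq_bigr => c _.
exact: inner_suml.
Qed.

Lemma marked_flow_root_gt0 v a b c d : marked_square adj v a b c d ->
  0 < inner (marked_flow v) (arrow a b).
Proof.
move=> sq; rewrite inner_marked_flow.
under eq_bigr do under eq_bigr do under eq_bigr do
  under eq_bigr => t sqt do rewrite (marked_square_inner_root sq sqt).
(* All terms are 0 or 1; isolating the given square in the four sums leaves a term equal to 1. *)
rewrite (bigD1 a) //= ltr_wpDr //; first by do 4!apply: sumr_ge0 => ? _.
rewrite (bigD1 b) //= ltr_wpDr //; first by do 3!apply: sumr_ge0 => ? _.
rewrite (bigD1 c) //= ltr_wpDr //; first by do 2!apply: sumr_ge0 => ? _.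
rewrite (bigD1 d) //= ltr_wpDr //; first by apply: sumr_ge0 => ? _.
by rewrite !eqxx ltr01.
Qed.

Lemma marked_flow_neighbor_eq0 a b : inner (marked_flow a) (arrow a b) = 0.
Proof.
rewrite inner_marked_flow; do 3!(rewrite big1 // => ? _).
by rewrite big1 // => ? /marked_square_inner_neighbor.
Qed.

Lemma perturbed_projection_nonorthogonal v a b c d :
  marked_square adj v a b c d -> ~ orthogonal_projection perturbed_projection.
Proof.
move=> sq [_ orth]; have va : adj v a by case/andP: sq.
(* The divergence of this single arrow is the unit potential at [a] minus that at [v]. *)
set F := arrow v a; pose S := flow_map (divergence F).
have S0 : divergence S = 0 by apply: divergence_flow_map.
(* [F] minus its projection is a gradient minus [S]. The gradient is orthogonal to the cycle [S], so
   orthogonality forces the inner product of [S] with itself to vanish. *)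
have {}orth : S = 0.
  have [g FE] := cycle_projectionE F.
  have /cycle_space_divergence := S0; move=> /(orth F).
  rewrite /= /perturbed_projection {1}FE -/S opprD addrACA subrr add0r.
  rewrite innerDl divergence_gradient_orthogonal // add0r innerNl.
  by move=> /eqP; rewrite oppr_eq0 => /eqP /inner_eq0.
(* The arrow from [a] to [b] detects [S]: the flow marked at [a] avoids it, while the one marked at
   [v] is positive on it. *)
have : inner S (arrow a b) = 0 by rewrite orth -(scale0r 0) innerZl mul0r.
have -> : S = marked_flow a - marked_flow v.
  rewrite /S /flow_map; under eq_bigr do rewrite divergence_arrow // scalerBl.
  rewrite sumrB (bigD1 a) //= eqxx big1 => [|u /negPf ne]; last first.
    by rewrite eq_sym ne scale0r.
  rewrite (bigD1 v) //= eqxx big1 => [|u /negPf ne]; last first.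
    by rewrite eq_sym ne scale0r.
  by rewrite !scale1r !addr0.
rewrite innerDl innerNl marked_flow_neighbor_eq0 add0r => /eqP.
by rewrite oppr_eq0 (negPf (lt0r_neq0 (marked_flow_root_gt0 sq))).
Qed.

End Nonorthogonal.

End InvariantProjection.

(** * Adjacency and absence of triangles in the torus *)

Section Torus.
Variables (n m : nat).
Hypothesis hn : (5 <= n)%N.

Lemma Zp_nat_neq0 k : (0 < k < n)%N -> (k%:R : 'Z_n) <> 0.
Proof.
move=> /andP[k0 kn] /(congr1 val) /=; rewrite val_Zp_nat ?(leq_trans _ hn) //.
by rewrite modn_small // => kE; rewrite kE in k0.
Qed.

Lemma torus_adjP (u v : torus n m) :
  reflect (exists2 i, v i = u i + 1 \/ v i = u i - 1 &
             forall j, j != i -> v j = u j) (torus_adj u v).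
Proof.
apply: (iffP existsP) => -[i].
  case/andP=> /orP vi /forallP vj; exists i => [|j ji].
    by case: vi => /eqP->; [left | right].
  by apply/eqP; apply: (implyP (vj j)).
move=> vi vj; exists i; apply/andP; split.
  by case: vi => ->; rewrite eqxx ?orbT.
by apply/forallP => j; apply/implyP => ji; rewrite vj.
Qed.

Lemma torus_adj_sym : symmetric (@torus_adj n m).
Proof.
have sub (u v : torus n m) : torus_adj u v -> torus_adj v u.
  case/torus_adjP=> i vi vj; apply/torus_adjP; exists i => [|j /vj //].
  by case: vi => ->; [right; rewrite addrK | left; rewrite subrK].
by move=> u v; apply/idP/idP; apply: sub.
Qed.

Lemma Zp_absurd k (x y : 'Z_n) : (0 < k < 5)%N ->
  (x - y = k%:R \/ y - x = k%:R) -> x = y -> False.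
Proof.
move=> /andP[k0 k5] xy xE; apply: (@Zp_nat_neq0 k).
  by rewrite k0 (leq_trans k5).
by case: xy => <-; rewrite xE subrr.
Qed.

(** Every contradictory coordinate equation below has sides differing by a constant from 1 to 4, up
    to sign; [ring] finds which, and [n >= 5] makes it nonzero. *)
Ltac zp_absurd_at h :=
  exfalso; move: h;
  first [ apply: (@Zp_absurd 1) => //; first [left; ring | right; ring]
        | apply: (@Zp_absurd 2) => //; first [left; ring | right; ring]
        | apply: (@Zp_absurd 3) => //; first [left; ring | right; ring]
        | apply: (@Zp_absurd 4) => //; first [left; ring | right; ring] ].

(** An axis used by exactly one of the three steps would give a coordinate that fails to return, so
    all steps share one axis. There a signed sum of three units is 1 or 3 up to sign, nonzero mod
    [n]. *)
Lemma torus_triangle_free (u v x : torus n m) :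
  torus_adj u v -> torus_adj u x -> torus_adj v x -> False.
Proof.
case/torus_adjP=> i vi vE /torus_adjP[j xj xE] /torus_adjP[k xk xvE].
have [ik|/eqP ik] := eqVneq i k; last first.
  have ki : k != i by apply/eqP => ki; apply: ik.
  have [jk|kj] := eqVneq k j; last first.
    have h := xE k kj; rewrite -(vE k ki) in h.
    by case: xk; rewrite h => h'; zp_absurd_at h'.
  have ij : i != j by apply/eqP => ij; apply: ik; rewrite jk.
  have h := xvE i; rewrite (xE i ij) in h.
  have {}h : u i = v i by apply: h; rewrite eq_sym.
  by case: vi; rewrite h => h'; zp_absurd_at h'.
subst k; have [ij|ji] := eqVneq j i; last first.
  have h := xvE j ji; rewrite (vE j ji) in h.
  by case: xj; rewrite h => h'; zp_absurd_at h'.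
subst j; case: xk => h; case: vi => vi; case: xj => xj; rewrite vi xj in h;
  zp_absurd_at h.
Qed.

(** * An explicit marked square in a coordinate plane *)

Section MarkedSquare.
Variables (i0 i1 : 'I_m).
Hypothesis i01 : i1 != i0.

Definition planar_point (x y : 'Z_n) : torus n m :=
  [ffun j => if j == i0 then x else if j == i1 then y else 0].

Lemma planar_point0 x y : planar_point x y i0 = x.
Proof. by rewrite ffunE eqxx. Qed.

Lemma planar_point1 x y : planar_point x y i1 = y.
Proof. by rewrite ffunE (negPf i01) eqxx. Qed.

Lemma planar_adj0 x y : torus_adj (planar_point x y) (planar_point (x + 1) y).
Proof.
apply/torus_adjP; exists i0 => [|j /negPf ji]; first by left; rewrite !planar_point0.
by rewrite !ffunE ji.
Qed.

Lemma planar_adj1 x y : torus_adj (planar_point x y) (planar_point x (y + 1)).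
Proof.
apply/torus_adjP; exists i1 => [|j /negPf ji]; first by left; rewrite !planar_point1.
by rewrite !ffunE ji.
Qed.

(** The two points differ by 2 on the axis [i0], so both steps to [x] run along that axis and meet
    in the middle. *)
Lemma planar_common_neighbor x :
  torus_adj (planar_point 0 0) x -> torus_adj (planar_point (1 + 1) 0) x ->
  x = planar_point 1 0.
Proof.
case/torus_adjP=> i xi xE /torus_adjP[k xk xE'].
have [ik|ki] := eqVneq k i0; last first.
  have h := xE' i0; rewrite eq_sym ki planar_point0 in h.
  have {}h := h isT.
  have [ii|ii] := eqVneq i0 i; last first.
    by have h' := xE _ ii; rewrite h planar_point0 in h'; zp_absurd_at h'.
  by case: xi; rewrite -ii h planar_point0 => h'; zp_absurd_at h'.
subst k; rewrite planar_point0 in xk.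
have [ii|ii] := eqVneq i0 i; last first.
  have h' := xE _ ii; rewrite planar_point0 in h'.
  by case: xk; rewrite h' => h; zp_absurd_at h.
subst i; rewrite planar_point0 in xi.
(* The other candidate, -1, differs from 3 by 4: here [n = 4] would allow a second common
   neighbour. *)
have x1 : x i0 = 1.
  case: xi => xi; first by rewrite xi add0r.
  by case: xk => h; rewrite xi in h; zp_absurd_at h.
apply/ffunP => j; have [->|ji] := eqVneq j i0; first by rewrite planar_point0.
by rewrite xE // !ffunE (negPf ji).
Qed.

Lemma planar_marked_square :
  marked_square (@torus_adj n m) (planar_point 0 0) (planar_point 1 0)
    (planar_point (1 + 1) 0) (planar_point (1 + 1) 1) (planar_point 1 1).
Proof.
have va : torus_adj (planar_point 0 0) (planar_point 1 0).
  by rewrite -[1]add0r planar_adj0.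
have adj01 x : torus_adj (planar_point x 0) (planar_point x 1).
  by rewrite -[1]add0r planar_adj1.
rewrite /marked_square va planar_adj0 adj01.
rewrite torus_adj_sym planar_adj0 torus_adj_sym adj01 /=.
have -> /= : planar_point (1 + 1) 1 != planar_point 1 0.
  apply/eqP => /ffunP /(_ i1); rewrite !planar_point1 => h.
  by zp_absurd_at h.
apply/andP; split.
  apply/cards1P; exists (planar_point 1 0); apply/setP => x; rewrite !inE.
  apply/andP/eqP => [[]|->]; first exact: planar_common_neighbor.
  by rewrite va torus_adj_sym planar_adj0.
apply/negP => /cards1P[z sE].
(* The root and the diagonal point (1, 1) have the two common neighbours (1, 0) and (0, 1). *)
have /set1P az : planar_point 1 0 \in [set z].
  by rewrite -sE inE va torus_adj_sym adj01.
have /set1P : planar_point 0 1 \in [set z].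
  by rewrite -sE inE adj01 torus_adj_sym -{2}[1]add0r planar_adj0.
rewrite -az => /ffunP /(_ i0); rewrite !planar_point0 => h.
by zp_absurd_at h.
Qed.

End MarkedSquare.

End Torus.

Theorem theorem38 (R : realType) (n m : nat) (hn : (5 <= n)%N) (hm : (2 <= m)%N)
    (o : rel (torus n m)) (ho : orientation_of (@torus_adj n m) o) :
  exists P : {linear edge_space R o -> edge_space R o},
    invariant_projection (@torus_adj n m) P /\ ~ orthogonal_projection P.
Proof.
have adj_sym := @torus_adj_sym n m.
exists (perturbed_projection (@torus_adj n m) (o := o)); split.
  exact: perturbed_projection_invariant.
(* Two distinct axes, 0 and 1, exist because [2 <= m]. *)
pose i0 := Ordinal (ltnW hm); pose i1 := Ordinal hm.
apply: (perturbed_projection_nonorthogonal ho adj_sym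
  (@torus_triangle_free n m hn) (@planar_marked_square n m hn i0 i1 _)).
by [].
Qed.
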